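(* Let $n\geq 1$ and let $\mathcal{N}:L_n([0,1])\to L_n([0,1])$ be an $n$-dimensional strong fuzzy negation. Then there exists an element $/e/\in\mathcal{D}_n$ such that $/e/$ is an $n$-dimensional equilibrium point of $\mathcal{N}$, i.e. $\mathcal{N}(/e/)=/e/$.
   Context: $L_n([0,1])=\{(x_1,\ldots,x_n)\in[0,1]^n : x_1\leq\cdots\leq x_n\}$ with the componentwise order. For $x\in[0,1]$, $/x/=(x,\ldots,x)$; $\mathcal{D}_n=\{/x/ : x\in[0,1]\}$. An $n$-dimensional fuzzy negation is a function $\mathcal{N}:L_n([0,1])\to L_n([0,1])$ with $\mathcal{N}(/0/)=/1/$, $\mathcal{N}(/1/)=/0/$ and $\mathcal{N}(\mathbf{x})\geq\mathcal{N}(\mathbf{y})$ whenever $\mathbf{x}\leq\mathbf{y}$. It is strong if $\mathcal{N}(\mathcal{N}(\mathbf{x}))=\mathbf{x}$ for all $\mathbf{x}$. *)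

(* Defs.v *)
From mathcomp Require Import all_boot all_order all_algebra interval_inference.
From mathcomp Require Import classical_sets reals.

Set Implicit Arguments.
Unset Strict Implicit.
Unset Printing Implicit Defensive.

Import Order.TTheory GRing.Theory Num.Theory.
Local Open Scope ring_scope.
Local Open Scope classical_set_scope.

(* [{i01 R}] is the library's type of the real numbers in the closed interval
   [0, 1], ordered as in [R]. *)
Definition Ln (R : realType) (n : nat) : Type :=
  {x : n.-tuple {i01 R} | sorted <=%O x}.

Definition Ln_le (R : realType) (n : nat) (x y : Ln R n) : Prop :=
  forall i : 'I_n, tnth (val x) i <= tnth (val y) i.

Lemma sorted_nseq (R : realType) (n : nat) (x : {i01 R}) :
  sorted <=%O (nseq_tuple n x).
Proof.
by apply: (@pairwise_sorted _ <=%O); elim: n => //= n ->;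
   rewrite all_nseq lexx orbT.
Qed.

(* Usually written /x/. *)
Definition degen (R : realType) (n : nat) (x : {i01 R}) : Ln R n :=
  exist _ (nseq_tuple n x) (sorted_nseq n x).

Definition Dn (R : realType) (n : nat) : set (Ln R n) := range (@degen R n).

Definition fuzzy_negation (R : realType) (n : nat) (N : Ln R n -> Ln R n) :
    Prop :=
  [/\ N (degen n 0%:i01) = degen n 1%:i01,
      N (degen n 1%:i01) = degen n 0%:i01
    & forall x y : Ln R n, Ln_le x y -> Ln_le (N y) (N x)].

Definition strong (R : realType) (n : nat) (N : Ln R n -> Ln R n) : Prop :=
  forall x : Ln R n, N (N x) = x.

Definition equilibrium_point (R : realType) (n : nat) (N : Ln R n -> Ln R n)
    (x : Ln R n) : Prop :=
  N x = x.

(* Main.v *)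
(* The negation N is an involutive order anti-automorphism of a lattice. Each
   /t/ is both join-prime and meet-prime, hence so is N /t/. A join-prime tuple
   has all its coordinates in {0, max} and a meet-prime one has them in
   {min, 1}; so N /t/ is either degenerate or a nonconstant 0-1 tuple.
   If N /t/ were a nonconstant 0-1 tuple, then so would be N /s/ for all
   t < s < 1, with strictly fewer ones: by density of [0, 1] this can be
   repeated forever, which is absurd. Hence N /t/ = /f t/ for an antitone
   involution f of [0, 1], and f fixes the supremum of {x | x <= f x}. *)
Require Import Defs.
From mathcomp Require Import all_boot all_order all_algebra interval_inference.
From mathcomp Require Import classical_sets reals.

Set Implicit Arguments.
Unset Strict Implicit.
Unset Printing Implicit Defensive.

Import Order.TTheory GRing.Theory Num.Theory.
Local Open Scope ring_scope.

Lemma i01_ge0 (R : realType) (x : {i01 R}) : 0%:i01 <= x.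
Proof. by rewrite -num_le /= ge0. Qed.

Lemma i01_le1 (R : realType) (x : {i01 R}) : x <= 1%:i01.
Proof. by rewrite -num_le /= le1. Qed.

Lemma i01_dense (R : realType) (x y : {i01 R}) :
  x < y -> exists2 z : {i01 R}, x < z & z < y.
Proof.
rewrite -num_lt => xy; have [xz zy] := midf_lt xy.
have z0 : 0 <= (x%:num + y%:num) / 2 :> R by apply: ltW (le_lt_trans _ xz).
have z1 : (x%:num + y%:num) / 2 <= 1 :> R.
  by apply: ltW (lt_le_trans zy _).
by exists (Itv01 z0 z1); rewrite -num_lt.
Qed.

Lemma i01_lub (R : realType) (A : set {i01 R}) : (A !=set0)%classic ->
  exists2 e : {i01 R}, ubound A e & forall b, ubound A b -> e <= b.
Proof.
move=> [a Aa]; pose B : set R := [set x%:num | x in A]%classic.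
have Bn0 : (B !=set0)%classic by exists a%:num, a.
have ubB b : ubound A b -> ubound B b%:num.
  by move=> Ab _ [x Ax <-]; rewrite num_le; exact: Ab.
have supB : has_ubound B.
  by exists 1; apply: (ubB 1%:i01) => x _; exact: i01_le1.
have s0 : 0 <= sup B by apply: le_trans (ub_le_sup supB _); last by exists a.
have s1 : sup B <= 1.
  by apply: ge_sup => // _ [x _ <-]; apply: le1.
exists (Itv01 s0 s1) => [x Ax|b Ab]; rewrite -num_le /=.
  by apply: ub_le_sup => //; exists x.
by apply: ge_sup => //; exact: ubB.
Qed.

Lemma antitone_involution_fixpoint (R : realType) (f : {i01 R} -> {i01 R}) :
  {homo f : x y /~ x <= y} -> involutive f -> exists e, f e = e.
Proof.
move=> f_anti fK; pose A : set {i01 R} := [set x | x <= f x]%classic.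
have [|e ubA lubA] := @i01_lub R A; first by exists 0%:i01; exact: i01_ge0.
have le_ef : e <= f e.
  (* For [x] in [A], the value [f x] is itself an upper bound of [A], so [e <= f x]; applying [f]
     gives [x <= f e]. *)
  apply: (lubA) => x Ax; rewrite -[x]fK; apply: (f_anti); apply: (lubA) => y Ay.
  have [yx|/ltW xy] := leP y x; first exact: le_trans yx Ax.
  by apply: le_trans Ay _; exact: f_anti.
exists e; apply/eqP; rewrite eq_le le_ef andbT leNgt; apply/negP => lt_ef.
(* No continuity is used: either [m] or [f m] lies in [A]. The first contradicts [e < m]; the second
   gives [f m <= e], hence [f e <= m]. *)
have [m em mf] := i01_dense lt_ef.
have [/ubA|fm] := leP m (f m); first by rewrite leNgt em.
have /ubA/f_anti : A (f m) by rewrite /A /= fK ltW.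
by rewrite fK leNgt mf.
Qed.

Lemma Ln_tnth_le (R : realType) (n : nat) (x : Ln R n) (i j : 'I_n) :
  (i <= j)%N -> tnth (val x) i <= tnth (val x) j.
Proof.
move=> ij; rewrite !(tnth_nth 0%:i01).
by apply: (sorted_leq_nth le_trans lexx _ (valP x)); rewrite ?inE ?size_tuple.
Qed.

Lemma Ln_mk (R : realType) (n : nat) (f : 'I_n -> {i01 R}) :
  (forall i j : 'I_n, (i <= j)%N -> f i <= f j) ->
  exists x : Ln R n, forall i, tnth (val x) i = f i.
Proof.
move=> f_homo; suff sf : sorted <=%O (mktuple f).
  by exists (exist _ (mktuple f) sf) => i; rewrite tnth_mktuple.
case: n f f_homo => [|n] f f_homo; first by rewrite (tuple0 (mktuple f)).
apply/(sortedP 0%:i01) => i; rewrite size_tuple => lti.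
have := f_homo (Ordinal (ltnW lti)) (Ordinal lti) (leqnSn i).
by rewrite -!(tnth_mktuple f) !(tnth_nth 0%:i01).
Qed.

Lemma Ln_le_anti (R : realType) (n : nat) (x y : Ln R n) :
  Ln_le x y -> Ln_le y x -> x = y.
Proof.
by move=> xy yx; apply/val_inj/eq_from_tnth => i; apply/le_anti; rewrite xy yx.
Qed.

Lemma tnth_degen (R : realType) (n : nat) (t : {i01 R}) (i : 'I_n) :
  tnth (val (degen n t)) i = t.
Proof. exact: tnth_nseq. Qed.

Lemma degen_inj (R : realType) (n : nat) : injective (@degen R n.+1).
Proof.
by move=> s t st; rewrite -(@tnth_degen _ n.+1 s ord0) st tnth_degen.
Qed.

Section StrongNegation.
Context (R : realType) (n : nat) (N : Ln R n.+1 -> Ln R n.+1).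
Hypotheses (negN : fuzzy_negation N) (strongN : strong N).

Let N_anti x y : Ln_le x y -> Ln_le (N y) (N x).
Proof. by case: negN => _ _; apply. Qed.

(** The hypothesis encodes N /t/ <= p ∨ q. Applying [N] turns it into N p ∧ N q <= /t/. Lying below
    /t/ depends only on the last coordinate, where totality of the order selects [N p] or [N q]. *)
Lemma neg_join_prime (t : {i01 R}) (p q : Ln R n.+1) :
  (forall z, Ln_le p z -> Ln_le q z -> Ln_le (N (degen _ t)) z) ->
  Ln_le (N (degen _ t)) p \/ Ln_le (N (degen _ t)) q.
Proof.
move=> lub.
have [z zE] := @Ln_mk R n.+1
  (fun i => Order.min (tnth (val (N p)) i) (tnth (val (N q)) i))
  (fun i j ij => le_min2 (Ln_tnth_le (N p) ij) (Ln_tnth_le (N q) ij)).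
have pz : Ln_le p (N z).
  by rewrite -[p]strongN; apply: (N_anti) => i; rewrite zE ge_min lexx.
have qz : Ln_le q (N z).
  by rewrite -[q]strongN; apply: (N_anti) => i; rewrite zE ge_min lexx orbT.
have /N_anti/(_ ord_max) := lub _ pz qz.
rewrite !strongN zE tnth_degen ge_min => /orP[] le_t; [left|right].
  rewrite -[p]strongN; apply: (N_anti) => i; rewrite tnth_degen.
  by apply: le_trans le_t; apply: Ln_tnth_le; rewrite -ltnS ltn_ord.
rewrite -[q]strongN; apply: (N_anti) => i; rewrite tnth_degen.
by apply: le_trans le_t; apply: Ln_tnth_le; rewrite -ltnS ltn_ord.
Qed.

(** Dual argument: lying above /t/ depends only on the first coordinate. *)
Lemma neg_meet_prime (t : {i01 R}) (p q : Ln R n.+1) :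
  (forall z, Ln_le z p -> Ln_le z q -> Ln_le z (N (degen _ t))) ->
  Ln_le p (N (degen _ t)) \/ Ln_le q (N (degen _ t)).
Proof.
move=> glb.
have [z zE] := @Ln_mk R n.+1
  (fun i => Order.max (tnth (val (N p)) i) (tnth (val (N q)) i))
  (fun i j ij => le_max2 (Ln_tnth_le (N p) ij) (Ln_tnth_le (N q) ij)).
have pz : Ln_le (N z) p.
  by rewrite -[p]strongN; apply: (N_anti) => i; rewrite zE le_max lexx.
have qz : Ln_le (N z) q.
  by rewrite -[q]strongN; apply: (N_anti) => i; rewrite zE le_max lexx orbT.
have /N_anti/(_ ord0) := glb _ pz qz.
rewrite !strongN zE tnth_degen le_max => /orP[] le_t; [left|right].
  rewrite -[p]strongN; apply: (N_anti) => i; rewrite tnth_degen.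
  by apply: le_trans le_t _; apply: Ln_tnth_le.
rewrite -[q]strongN; apply: (N_anti) => i; rewrite tnth_degen.
by apply: le_trans le_t _; apply: Ln_tnth_le.
Qed.

Lemma neg_degen_0_or_max (t : {i01 R}) (j : 'I_n.+1) :
  tnth (val (N (degen _ t))) j = 0%:i01 \/
  forall i, tnth (val (N (degen _ t))) i <= tnth (val (N (degen _ t))) j.
Proof.
set u := N _; set c := tnth (val u) j.
(* [u] is the join of [u] with its coordinates [<= c] erased, and of [u]
   truncated at [c]. *)
have [|p pE] := @Ln_mk R n.+1
    (fun i => if tnth (val u) i <= c then 0%:i01 else tnth (val u) i).
  move=> i k ik; case: ifP => [_|/negbT]; first exact: i01_ge0.
  rewrite -ltNge => ci.
  by rewrite ifN ?(Ln_tnth_le u ik) // -ltNge (lt_le_trans ci) ?Ln_tnth_le.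
have [q qE] := @Ln_mk R n.+1 (fun i => Order.min (tnth (val u) i) c)
  (fun i k ik => le_min2 (Ln_tnth_le u ik) (lexx c)).
have [z pz qz i|up|uq] := @neg_join_prime t p q.
- have [ic|ci] := leP (tnth (val u) i) c.
    by have := qz i; rewrite qE min_l.
  by have := pz i; rewrite pE (lt_geF ci).
- by left; apply/le_anti; rewrite i01_ge0 andbT; have := up j; rewrite pE lexx.
- by right => i; have := uq i; rewrite qE le_min => /andP[].
Qed.

Lemma neg_degen_1_or_min (t : {i01 R}) (j : 'I_n.+1) :
  tnth (val (N (degen _ t))) j = 1%:i01 \/
  forall i, tnth (val (N (degen _ t))) j <= tnth (val (N (degen _ t))) i.
Proof.
set u := N _; set c := tnth (val u) j.
(* Dually, [u] is the meet of [u] with its coordinates [>= c] replaced by 1, and of [u] raised to at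
   least [c]. *)
have [|p pE] := @Ln_mk R n.+1
    (fun i => if c <= tnth (val u) i then 1%:i01 else tnth (val u) i).
  move=> i k ik; case: (leP c (tnth (val u) k)) => [_|kc].
    by case: ifP => _; exact: i01_le1.
  by rewrite ifN ?(Ln_tnth_le u ik) // -ltNge (le_lt_trans _ kc) ?Ln_tnth_le.
have [q qE] := @Ln_mk R n.+1 (fun i => Order.max (tnth (val u) i) c)
  (fun i k ik => le_max2 (Ln_tnth_le u ik) (lexx c)).
have [z pz qz i|up|uq] := @neg_meet_prime t p q.
- have [ic|ci] := leP c (tnth (val u) i).
    by have := qz i; rewrite qE max_l.
  by have := pz i; rewrite pE (lt_geF ci).
- by left; apply/le_anti; rewrite i01_le1 /=; have := up j; rewrite pE lexx.
- by right => i; have := uq i; rewrite qE ge_max => /andP[].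
Qed.

Lemma neg_degen_cases (t : {i01 R}) :
  (exists s, N (degen _ t) = degen _ s) \/
  [/\ tnth (val (N (degen _ t))) ord0 = 0%:i01,
      tnth (val (N (degen _ t))) ord_max = 1%:i01
    & forall i, tnth (val (N (degen _ t))) i = 0%:i01 \/
                tnth (val (N (degen _ t))) i = 1%:i01].
Proof.
set u := N _; have [emax|nmax] := eqVneq (tnth (val u) ord0)
                                        (tnth (val u) ord_max).
  left; exists (tnth (val u) ord0); apply: Ln_le_anti => i; rewrite tnth_degen.
    by rewrite emax Ln_tnth_le // -ltnS ltn_ord.
  exact: Ln_tnth_le.
have lt0m : tnth (val u) ord0 < tnth (val u) ord_max.
  by rewrite lt_neqAle nmax Ln_tnth_le.
right; split=> [||i].
- have [//|/(_ ord_max)] := neg_degen_0_or_max t ord0.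
  by rewrite leNgt lt0m.
- have [//|/(_ ord0)] := neg_degen_1_or_min t ord_max.
  by rewrite leNgt lt0m.
(* A coordinate that is neither 0 nor 1 would be both largest and smallest, making [u] constant. *)
- have [|/(_ ord_max) imax] := neg_degen_0_or_max t i; first by left.
  have [|/(_ ord0) imin] := neg_degen_1_or_min t i; first by right.
  by have := le_trans imax imin; rewrite leNgt lt0m.
Qed.

Lemma neg_degen (t : {i01 R}) : exists s, N (degen _ t) = degen _ s.
Proof.
(* Strong induction on the number of coordinates of N /t/ equal to 1. *)
have [N0 N1 _] := negN.
pose ones x := [set i | (tnth (val (N (degen n.+1 x))) i)%:num >= 1 :> R].
have [k] := ubnP #|ones t|; elim: k t => // k IHk t; rewrite ltnS => le_k.
have [//|[u0 _ u01]] := neg_degen_cases t.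
have [t1|nt1] := eqVneq t 1%:i01; first by exists 0%:i01; rewrite t1 N1.
(* Strictness on both sides matters: [t < s] makes the count drop, and [s < 1] rules out N /s/ =
   /0/. *)
have [|s ts s1] := @i01_dense R t 1%:i01; first by rewrite lt_neqAle nt1 i01_le1.
have le_st : Ln_le (N (degen _ s)) (N (degen _ t)).
  by apply: (N_anti) => i; rewrite !tnth_degen ltW.
suff /IHk[r Nsr] : (#|ones s| < k)%N.
  (* Then [N /s/ = /r/ <= N /t/] forces [r = 0], hence [s = 1]. *)
  have r0 : r = 0%:i01.
    apply/le_anti; rewrite i01_ge0 andbT -u0 -(@tnth_degen _ n.+1 r ord0) -Nsr.
    exact: le_st.
  have s1E : s = 1%:i01.
    by apply: (@degen_inj R n); rewrite -[LHS]strongN Nsr r0 N0.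
  by rewrite s1E ltxx in s1.
apply: leq_trans le_k; apply: proper_card; rewrite properE; apply/andP; split.
  apply/fintype.subsetP => i; rewrite !inE => /le_trans; apply.
  by rewrite num_le le_st.
(* If no 1 were lost, then N /t/ <= N /s/ because N /t/ has only 0-1 coordinates; the two images
   would coincide, forcing [t = s]. *)
apply/negP => /fintype.subsetP sub_ts.
have /Ln_le_anti/(_ le_st) : Ln_le (N (degen _ t)) (N (degen _ s)).
  move=> i; have [->|ti1] := u01 i; first exact: i01_ge0.
  by have := sub_ts i; rewrite !inE ti1 -num_le; apply; exact: lexx.
move=> /(congr1 N); rewrite !strongN => /degen_inj tsE.
by rewrite tsE ltxx in ts.
Qed.

End StrongNegation.

Theorem corollary27 (R : realType) (n : nat) (n_ge1 : (1 <= n)%N)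
    (N : Ln R n -> Ln R n) (negN : fuzzy_negation N) (strongN : strong N) :
  exists e : Ln R n, @Dn R n e /\ equilibrium_point N e.
Proof.
case: n n_ge1 N negN strongN => // n _ N negN strongN.
(* Since N /t/ is constant, any coordinate would do; [ord0] exists because the length is
   positive. *)
pose f t := tnth (val (N (degen n.+1 t))) ord0.
have Nf t : N (degen _ t) = degen _ (f t).
  by have [s Ns] := neg_degen negN strongN t; rewrite /f Ns tnth_degen.
have [s t st|t|e fe] := @antitone_involution_fixpoint R f.
- by have [_ _] := negN; apply => i; rewrite !tnth_degen.
- by apply: (@degen_inj R n); rewrite -!Nf strongN.
- by exists (degen _ e); split; [exists e | rewrite /equilibrium_point Nf fe].
Qed.
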